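(* Let $G$ be a finite solvable group and let $\chi\in\mathrm{Irr}(G)$. Then there exist a cyclic subgroup $H$ of $G$ and an irreducible constituent $\lambda\in\mathrm{Irr}(H)$ of the restriction $\chi_H$ such that $c(\chi)$ divides $o(\lambda)$.
   Context: Characters are complex. $\mathbb{Q}(\chi)$ is the field generated by the values of $\chi$; the conductor $c(\chi)$ is the smallest integer $n>0$ such that $\mathbb{Q}(\chi)$ is contained in the $n$-th cyclotomic field. For a linear character $\lambda$ of $H$, $o(\lambda)$ is its order in the group of linear characters of $H$. *)

(* Defs.v *)
From HB Require Import structures.
From mathcomp Require Import all_boot all_order all_algebra all_fingroup.
From mathcomp Require Import all_solvable all_field all_character.

Set Implicit Arguments.
Unset Strict Implicit.
Unset Printing Implicit Defensive.

Import Order.TTheory GRing.Theory Num.Theory.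
Local Open Scope ring_scope.

(* The subfield of algC generated by S. Constructor gen_div is unguarded: as  *)
(* x / 0 = 0 in algC, division by zero adds nothing.                          *)
Inductive gen_field (S : algC -> Prop) : algC -> Prop :=
  | gen_mem x : S x -> gen_field S x
  | gen_one : gen_field S 1
  | gen_sub x y : gen_field S x -> gen_field S y -> gen_field S (x - y)
  | gen_div x y : gen_field S x -> gen_field S y -> gen_field S (x / y).

Definition cyclotomic_field (n : nat) : algC -> Prop :=
  gen_field (fun z => n.-primitive_root z).

Definition char_field (gT : finGroupType) (G : {group gT}) (phi : 'CF(G)) :
  algC -> Prop := gen_field (fun z => exists2 x, x \in G & z = phi x).

Definition field_incl (E F : algC -> Prop) : Prop := forall z, E z -> F z.

Section GenField.

Variable S : algC -> Prop.

Lemma gen0 : gen_field S 0.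
Proof. by rewrite -(subrr 1); do 2![apply: gen_sub || apply: gen_one]. Qed.

Lemma genN x : gen_field S x -> gen_field S (- x).
Proof. by move=> Sx; rewrite -sub0r; apply: gen_sub gen0 Sx. Qed.

Lemma genD x y : gen_field S x -> gen_field S y -> gen_field S (x + y).
Proof. by move=> Sx Sy; rewrite -[y]opprK; apply/gen_sub/genN. Qed.

Lemma genM x y : gen_field S x -> gen_field S y -> gen_field S (x * y).
Proof.
move=> Sx Sy; rewrite -[y]invrK; apply: gen_div Sx _.
by rewrite -[y^-1]mul1r; apply: gen_div Sy; apply: gen_one.
Qed.

Lemma genX x n : gen_field S x -> gen_field S (x ^+ n).
Proof.
move=> Sx; elim: n => [|n IHn]; first exact: gen_one.
by rewrite exprS; apply: genM.
Qed.

Lemma gen_sum (I : Type) (r : seq I) (P : pred I) (F : I -> algC) :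
  (forall i, P i -> gen_field S (F i)) -> gen_field S (\sum_(i <- r | P i) F i).
Proof. by move=> SF; apply: big_ind => //; [apply: gen0 | apply: genD]. Qed.

Lemma gen_rat (a : rat) : gen_field S (ratr a).
Proof.
have genz (m : int) : gen_field S m%:~R.
  have genn n : gen_field S n%:R.
    elim: n => [|n IHn]; first exact: gen0.
    by rewrite mulrS; apply/genD/IHn/gen_one.
  case: m => n; first exact: genn.
  by rewrite NegzE mulrNz; apply: genN; apply: genn.
by apply: gen_div; apply: genz.
Qed.

Lemma gen_field_sub (T : algC -> Prop) :
  (forall z, S z -> gen_field T z) -> field_incl (gen_field S) (gen_field T).
Proof.
move=> sST z; elim=> {z} [z /sST // | | x y _ Tx _ Ty | x y _ Tx _ Ty].
- exact: gen_one.
- exact: gen_sub.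
- exact: gen_div.
Qed.

Lemma gen_adjoin (L : fieldExtType rat) (f : {rmorphism L -> algC})
    (K : {subfield L}) (s : seq L) :
    (forall u, u \in K -> gen_field S (f u)) ->
    (forall u, u \in s -> gen_field S (f u)) ->
  forall u, u \in <<K & s>>%VS -> gen_field S (f u).
Proof.
elim: s K => [|x s IHs] K SK Ss u.
  by rewrite adjoin_nil subfield_closed; apply: SK.
rewrite adjoin_cons; apply: (IHs <<K; x>>%AS) => [v | v s_v]; last first.
  by apply: Ss; rewrite inE s_v orbT.
case/Fadjoin_polyP=> p /polyOverP Kp ->.
rewrite horner_coef rmorph_sum; apply: gen_sum => i _.
rewrite rmorphM rmorphXn; apply: genM; first exact: SK.
by apply/genX/Ss; rewrite inE eqxx.
Qed.

End GenField.

Lemma gen_field_dec (s : seq algC) z :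
  decidable (gen_field (fun x => x \in s) z).
Proof.
have [L [f [s1 Ds genL]]] := num_field_exists s.
have [g _ fK] := num_field_proj f.
apply: (@decP _ (f (g z) == z)); apply: (iffP eqP) => [<- | ].
  apply: (@gen_adjoin _ L f 1%AS s1) => [_ /vlineP[a ->] | u s1u | ].
  - by rewrite alg_num_field fmorph_rat; apply: gen_rat.
  - by apply: gen_mem; rewrite -Ds map_f.
  by rewrite genL memvf.
suffices imL x : gen_field (fun x => x \in s) x -> exists u, x = f u.
  by case/imL=> u ->; rewrite fK.
elim=> {x} [x | | _ _ _ [u ->] _ [v ->] | _ _ _ [u ->] _ [v ->]].
- by rewrite -Ds => /mapP[u _ ->]; exists u.
- by exists 1; rewrite rmorph1.
- by exists (u - v); rewrite rmorphB.
by exists (u / v); rewrite fmorph_div.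
Qed.

Lemma cyclotomic_field_dec n z : (0 < n)%N -> decidable (cyclotomic_field n z).
Proof.
move=> n_gt0; have [w prim_w] := C_prim_root_exists n_gt0.
have [Qz | Qz'] := gen_field_dec [:: w] z; [left | right=> Qz; case: Qz'].
  by apply: gen_field_sub Qz => _ /[1!inE] /eqP->; apply: gen_mem.
apply: gen_field_sub Qz => x /prim_expr_order/(prim_rootP prim_w)[i ->].
by apply/genX/gen_mem; rewrite inE.
Qed.

Section Conductor.

Variables (gT : finGroupType) (G : {group gT}).

Lemma char_field_sub_dec (phi : 'CF(G)) n :
  decidable ((0 < n)%N /\ field_incl (char_field phi) (cyclotomic_field n)).
Proof.
case: (posnP n) => [-> | n_gt0]; first by right=> -[].
apply: (@decP _ [forall x in G, cyclotomic_field_dec (phi x) n_gt0]).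
apply: (iffP forall_inP) => [Qn_phi | [_ Qn_phi] x Gx].
  by split=> //; apply: gen_field_sub => _ [x Gx ->]; apply/sumboolP/Qn_phi.
by apply/sumboolP; apply: Qn_phi; apply: gen_mem; exists x.
Qed.

Lemma conductor_exists (i : Iirr G) :
  exists n, char_field_sub_dec 'chi_i n : bool.
Proof.
exists #|G|; apply/sumboolP; split=> //; apply: gen_field_sub => _ [x Gx ->].
have [rG ->] := char_reprP (irr_char i).
have [e [_ [e1 _] [-> _] _]] := repr_rsim_diag rG Gx.
have [w prim_w] := C_prim_root_exists (cardG_gt0 G).
apply: gen_sum => j _; have ej1: e 0 j ^+ #|G| = 1.
  by apply/eqP; rewrite -(divnK (order_dvdG Gx)) mulnC exprM e1 expr1n.
by have [k ->] := prim_rootP prim_w ej1; apply/genX/gen_mem.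
Qed.

(* The least n > 0 such that Q('chi_i) is contained in Q(zeta_n). It is       *)
(* defined on Iirr G as no such n need exist for an arbitrary class function. *)
Definition conductor (i : Iirr G) : nat := ex_minn (conductor_exists i).

Lemma conductorP (i : Iirr G) :
  [/\ (0 < conductor i)%N,
      field_incl (char_field 'chi_i) (cyclotomic_field (conductor i))
    & forall n, (0 < n)%N ->
        field_incl (char_field 'chi_i) (cyclotomic_field n) ->
        (conductor i <= n)%N].
Proof.
rewrite /conductor; case: ex_minnP => c /sumboolP[c_gt0 Qc] min_c.
by split=> // n n_gt0 Qn; apply: min_c; apply/sumboolP.
Qed.

End Conductor.

(* Main.v *)
From HB Require Import structures.
Require Import Defs.
From mathcomp Require Import all_boot all_order all_algebra all_fingroup.
From mathcomp Require Import all_solvable all_field all_character.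

(** Write c for the conductor of chi and, for a prime p dividing c, let p^e be
    the exact power of p in c. Since c is minimal, Q(chi) does not lie in
    Q(zeta_(c/p)), and an averaging argument yields an automorphism u_p of the
    complex algebraic numbers which moves chi, yet fixes the roots of unity of
    p'-order dividing #|G| and those of order dividing c/p
    ([conductor_prime_moved]). The order of a linear character of
    a subgroup of G that u_p moves is then divisible by p^e. So it is enough to
    find a cyclic H and a single constituent of the restriction of chi to H
    that is moved by all the u_p at once ([moved_constituent]).

    This follows once the alternating sum D(chi), the product of the operators
    1 - u_p applied to chi, is known to be nonzero: D(chi) is then nonzero at
    some g, so D(lambda) is nonzero for some constituent lambda of chi
    restricted to the group generated by g, and D kills every character fixed
    by one of the u_p. In D(chi) the coefficient of chi is 1 as soon as no
    nontrivial product of distinct u_p fixes chi, so the point is to show that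
    stabilisers split: if u fixes the roots of unity of p'-order, v those of
    p-power order, and uv fixes chi, then u already fixes chi. For a
    general chi this fails, because of diagonal stabilisers in the Galois
    group.

    If chi restricts non-homogeneously to a normal subgroup, it is induced by
    its Clifford correspondent psi in a proper subgroup; whatever moves chi
    moves psi, and the constituents of psi are among those of chi, so induction
    on the order of G applies. Otherwise chi is quasiprimitive and, as in the
    work of Gajendragadkar and Isaacs, it factors as a product of a p-special
    and a p'-special character, in an essentially unique way
    ([quasiprimitive_factored]). Now u acts on the first factor only and v on
    the second one only, so that uniqueness splits the stabiliser
    ([quasiprimitive_split]). The factorization climbs a chief series of G
    ([factored_over]): over a p'-factor, the p-special part extends canonically
    and the p'-special part moves to a constituent of an induced character, and
    symmetrically over a p-factor. *)

Set Implicit Arguments.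
Unset Strict Implicit.
Unset Printing Implicit Defensive.

Import Order.TTheory GroupScope GRing.Theory Num.Theory.
Local Open Scope ring_scope.

(** * Galois action on characters *)

Definition fixes_roots (u : {rmorphism algC -> algC}) n :=
  forall z, z ^+ n = 1 -> u z = z.

Lemma fixes_roots_dvd u m n : (m %| n)%N -> fixes_roots u n -> fixes_roots u m.
Proof.
by move=> /dvdnP[k ->] fix_u z zm1; apply: fix_u; rewrite mulnC exprM zm1 expr1n.
Qed.

Lemma fixes_roots_inv u n : fixes_roots u n -> fixes_roots (algC_invaut u) n.
Proof. by move=> fix_u z /fix_u uz; rewrite -[in LHS]uz /= algC_autK. Qed.

Section Automorphisms.

Variables (gT : finGroupType) (G : {group gT}).

Lemma cfAut_fixed u (phi : 'CF(G)) :
  fixes_roots u #|G| -> phi \is a character -> cfAut u phi = phi.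
Proof.
move=> fix_u /char_reprP[rG ->]; apply/cfun_inP=> x Gx; rewrite cfunE.
have [e [_ [e1 _] [-> _] _]] := repr_rsim_diag rG Gx.
rewrite rmorph_sum; apply: eq_bigr => j _; apply: fix_u.
by apply/eqP; rewrite -(divnK (order_dvdG Gx)) mulnC exprM e1 expr1n.
Qed.

Lemma cfAut_comm (v w : {rmorphism algC -> algC}) (phi : 'CF(G)) :
  phi \is a character -> cfAut v (cfAut w phi) = cfAut w (cfAut v phi).
Proof.
move=> Nphi; apply/cfun_inP=> x Gx; rewrite !cfunE.
have /char_reprP[rG ->] := Nphi.
have [e [_ [e1 _] [De _] _]] := repr_rsim_diag rG Gx.
rewrite !De !rmorph_sum; apply: eq_bigr => j _.
exact: aut_unity_rootC (e1 j).
Qed.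

Lemma cfDetAut u (phi : 'CF(G)) :
  phi \is a character -> cfDet (cfAut u phi) = cfAut u (cfDet phi).
Proof.
case/char_reprP=> rG ->.
have ->: cfAut u (cfRepr rG) = cfRepr (map_repr u rG).
  by apply/cfun_inP=> x Gx; rewrite !cfunE Gx map_reprE trace_map_mx.
rewrite !cfDetRepr; apply/cfun_inP=> x Gx.
by rewrite !cfunE Gx /= !mulr1n !trace_mx11 !mxE -det_map_mx.
Qed.

Lemma cfDet_order_conjg (phi : 'CF(G)) y : 'o((phi ^ y)%CF)%CF = 'o(phi)%CF.
Proof.
rewrite /cfDet_order cfDetConjg; apply: cforder_inj_rmorph.
exact: can_inj (cfConjgK y).
Qed.

Lemma cfDet_order_aut u i : 'o(cfAut u 'chi[G]_i)%CF = 'o('chi_i)%CF.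
Proof. by rewrite /cfDet_order cfDetAut ?irr_char ?cforder_aut. Qed.

End Automorphisms.

(** * Restricting characters over an invariant character *)

(** Distinct terms of the sum have inner product at least 0 and each term has
    norm at least 1, so the assumed value of the norm is the smallest possible
    one and every estimate is an equality. *)
Lemma orthonormal_of_norm (gT : finGroupType) (Q : {group gT}) (I : finType)
    (S : {pred I}) (e : I -> algC) (X : I -> 'CF(Q)) :
    {in S, forall b, e b > 0 /\ e b \in Num.nat} ->
    {in S, forall b, X b \is a character /\ X b != 0} ->
    '[\sum_(b in S) e b *: X b] = \sum_(b in S) e b ^+ 2 ->
  {in S &, forall b c, '[X b, X c] = (b == c)%:R}.
Proof.
move=> Se SX normS b c Sb Sc; apply/esym/eqP.
have eMmono d : d \in S -> _ := fun Sd => mono_leif (ler_pM2l (proj1 (Se d Sd))).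
suffices [_] : \sum_(b in S) e b * \sum_(c in S) e c * (b == c)%:R
    <= \sum_(b in S) e b * \sum_(c in S) e c * '[X b, X c]
    ?= iff [forall b in S, forall c in S, (b == c)%:R == '[X b, X c]].
- suff -> : \sum_(b in S) e b * (\sum_(c in S) e c * (b == c)%:R)
     = \sum_(b in S) e b * (\sum_(c in S) e c * '[X b, X c]).
    by rewrite eqxx => /esym/forall_inP/(_ b Sb)/forall_inP/(_ c Sc).
  rewrite cfdot_suml in normS.
  transitivity (\sum_(b in S) e b ^+ 2).
    apply: eq_bigr => d Sd; rewrite (bigD1 d) //= eqxx mulr1 big1 ?addr0 //.
    by move=> k /andP[_ ne_kd]; rewrite eq_sym (negPf ne_kd) mulr0.
  rewrite -normS; apply: eq_bigr => d Sd; rewrite cfdotZl cfdot_sumr.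
  congr (_ * _); apply: eq_bigr => k Sk.
  by rewrite cfdotZr conj_natr //; have [] := Se k Sk.
apply: leif_sum => d Sd; rewrite eMmono //.
apply: leif_sum => k Sk; rewrite eMmono //; split=> //.
have [[Xd nzXd] [Xk _]] := (SX d Sd, SX k Sk).
have /natrP[n Dn] : '[X d, X k] \in Num.nat by rewrite Cnat_cfdot_char.
have [Ddk | _] := eqP; rewrite Dn leC_nat // lt0n.
by rewrite -(eqr_nat algC) -Dn Ddk cfnorm_eq0 -Ddk.
Qed.

(** When N = MQ, the character of N induced by an invariant character of M
    restricts to Q as the character induced by the restriction to Q :&: M. Both
    have norm #|N : M|, hence restriction to Q is injective on the constituents
    and keeps them irreducible. *)
Lemma cfdot_Res_supplement (gT : finGroupType) (N M Q : {group gT}) (b : Iirr M) :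
    M <| N -> (M * Q = N)%g -> N \subset 'I['chi_b] ->
    'Res[Q :&: M] 'chi_b \in irr (Q :&: M) ->
  {in irr_constt ('Ind[N] 'chi_b) &, forall d k,
    '['Res[Q] 'chi_d, 'Res[Q] 'chi_k] = (d == k)%:R}.
Proof.
move=> nsMN defN INb irr_b; have [sMN nMN] := andP nsMN.
have sQN : Q \subset N by rewrite -defN mulG_subr.
have nsDQ : Q :&: M <| Q by rewrite /normal subsetIl normsI ?normG ?(subset_trans sQN).
have IQb : Q \subset 'I['Res[Q :&: M] 'chi_b].
  apply/subsetP=> y Qy; have Ny := subsetP sQN y Qy.
  rewrite inE (subsetP (normal_norm nsDQ)) //= cfConjgRes_norm ?(subsetP nMN) //.
    by rewrite (inertiaJ (subsetP INb y Ny)).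
  by rewrite (subsetP (normal_norm nsDQ)).
have idx : #|N : M| = #|Q : Q :&: M|.
  apply/eqP; rewrite -(eqn_pmul2l (cardG_gt0 M)) Lagrange //.
  rewrite -(eqn_pmul2r (cardG_gt0 (Q :&: M))) mulnAC -mulnA Lagrange ?subsetIl //.
  by rewrite (mul_cardG M Q) defN setIC.
have ResInd : 'Res[Q] ('Ind[N] 'chi_b) = 'Ind ('Res[Q :&: M] 'chi_b).
  apply/cfun_inP=> x Qx; rewrite cfResE //.
  have [Mx | M'x] := boolP (x \in M); last first.
    rewrite (cfun_on0 (cfInd_normal 'chi_b nsMN)) //.
    rewrite (cfun_on0 (cfInd_normal _ nsDQ)) //.
    by rewrite inE (negPf M'x) andbF.
  have Dx : x \in Q :&: M by rewrite inE Qx.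
  have := congr1 (fun f : 'CF(M) => f x) (cfRes_Ind_invariant nsMN INb).
  have := congr1 (fun f : 'CF(Q :&: M) => f x) (cfRes_Ind_invariant nsDQ IQb).
  by rewrite !cfResE ?subsetIl ?subsetIr // cfunE => ->;
     rewrite [in RHS]cfunE cfResE ?subsetIr // idx.
apply: (@orthonormal_of_norm _ _ _ _ (fun d => '['Ind[N] 'chi_b, 'chi_d])).
- move=> d Sd; rewrite natr_gt0 ?Cnat_cfdot_char ?cfInd_char ?irr_char //.
- move=> d _; rewrite cfRes_char ?irr_char //; split=> //.
  by rewrite -char1_eq0 ?cfRes_char ?irr_char // cfRes1 irr1_neq0.
have -> : \sum_(d in irr_constt ('Ind[N] 'chi_b)) '['Ind 'chi_b, 'chi_d] *:
     'Res[Q] 'chi_d = 'Res[Q] ('Ind[N] 'chi_b).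
  rewrite [in RHS](cfun_sum_constt ('Ind 'chi_b)) linear_sum.
  by apply: eq_bigr => d _; rewrite linearZ.
rewrite ResInd -cfdot_Res_l cfRes_Ind_invariant // cfdotZl irrWnorm // mulr1 -idx.
transitivity '['Ind[N] 'chi_b].
  by rewrite -cfdot_Res_l cfRes_Ind_invariant // cfdotZl cfnorm_irr mulr1.
rewrite {1}(cfun_sum_constt ('Ind 'chi_b)) cfdot_suml; apply: eq_bigr => d _.
rewrite cfdotZl expr2 cfdotC; congr (_ * _); rewrite -cfdotC.
by rewrite [in RHS]cfdotC conj_natr // Cnat_cfdot_char ?cfInd_char ?irr_char.
Qed.

Lemma constt_Ind_Res_mult (gT : finGroupType) (M N : {group gT})
    (b : Iirr M) (d : Iirr N) :
    M <| N -> N \subset 'I['chi_b] -> d \in irr_constt ('Ind[N] 'chi_b) ->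
  exists2 e : nat, (0 < e)%N & 'Res[M] 'chi_d = 'chi_b *+ e.
Proof.
move=> nsMN INb; rewrite constt_Ind_Res => dMb.
have /natrP[e De] : '['Res[M] 'chi_d, 'chi_b] \in Num.nat.
  by rewrite Cnat_cfdot_char ?cfRes_char ?irr_char.
exists e; first by move: dMb; rewrite irr_consttE De pnatr_eq0 lt0n.
rewrite (Clifford_Res_sum_cfclass nsMN dMb) De cfclass_invariant //.
by rewrite big_seq1 scaler_nat.
Qed.

(** * Special characters *)

Section SpecialFactors.

Variables (gT : finGroupType) (G : {group gT}).
Implicit Types (pi : nat_pred) (M N P : {group gT}).

(** A workable substitute for the pi-special characters of Gajendragadkar,
    relative to the ambient group G: only what the induction along a chief
    series of G transports is kept. The last clause says that the values lie in
    the field of the pi-part of the order of M. *)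
Definition special pi M (a : Iirr M) : Prop :=
  [/\ pi.-nat 'o('chi_a)%CF,
      G \subset 'I['chi_a],
      forall P, pi.-Hall(M) P -> 'Res[P] 'chi_a \in irr P
    & forall u, fixes_roots u #|M|`_pi -> cfAut u 'chi_a = 'chi_a].

(** The degree can be read off the restriction to a Hall pi-subgroup, whose
    order it divides. *)
Lemma special_degree pi M (a : Iirr M) :
  solvable M -> special pi a -> pi.-nat (Num.truncn ('chi_a 1%g)).
Proof.
move=> solM [_ _ hall_a _]; have [P hallP] := Hall_exists pi solM.
have [_ piP _] := and3P hallP.
have /irrP[k Dk] := hall_a P hallP.
have /natrP[n Dn] := Cnat_irr1 a; rewrite Dn natrK; apply: pnat_dvd piP.
by have := dvd_irr1_cardG k; rewrite -Dk cfRes1 Dn dvdC_nat.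
Qed.

Lemma Iirr1_eq0 (a : Iirr (1%G : {group gT})) : a = 0.
Proof.
apply/irr_inj; rewrite irr0; apply/cfun_inP=> x /set1P->.
by rewrite cfun11 lin_char1 //; apply/char_abelianP/abelian1.
Qed.

Lemma special1 pi (a : Iirr 1%G) : special pi a.
Proof.
split=> [||P|u _]; rewrite (Iirr1_eq0 a) ?inertia_irr0 ?norms1 // irr0.
- rewrite cfDet_order_lin ?cfun1_lin_char //; apply: (@pnat_dvd _ 1) => //.
  by rewrite dvdn_cforder expr1n.
- by case/and3P=> sP1 _ _; rewrite cfRes_cfun1 // cfun1_irr.
by rewrite rmorph1.
Qed.

(** Order and degree of a are coprime to the index, so among the extensions of
    a to N exactly one has a determinant of order coprime to the index.
    Uniqueness makes it inherit any symmetry of a, by conjugation or by a field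
    automorphism. *)
Lemma special_canonical_ext pi M N (a : Iirr M) :
    solvable N -> M <| G -> N <| G -> M \subset N -> pi^'.-nat #|N : M| ->
    special pi a ->
  exists c : Iirr N,
    [/\ 'Res[M] 'chi_c = 'chi_a, special pi c
      & forall d, 'Res[M] 'chi_d = 'chi_a -> 'o('chi_d)%CF = 'o('chi_c)%CF -> d = c].
Proof.
move=> solN nsMG nsNG sMN pi'NM spec_a.
have [oa Ia hall_a fix_a] := spec_a.
have nsMN : M <| N := normalS sMN (normal_sub nsNG) nsMG.
have sNG := normal_sub nsNG; have solM := solvableS sMN solN.
have co_o : coprime #|N : M| 'o('chi_a)%CF by rewrite coprime_sym (pnat_coprime oa).
have [|||c [cM oc Uc]] := @extend_solvable_coprime_irr _ N M a nsMN.
- exact: quotient_sol.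
- exact: subset_trans sNG Ia.
- by rewrite coprimeMr co_o coprime_sym (pnat_coprime (special_degree solM spec_a)).
have {}Uc d : 'Res[M] 'chi_d = 'chi_a -> 'o('chi_d)%CF = 'o('chi_c)%CF -> d = c.
  by move=> dM od; apply: Uc => //; rewrite od oc.
exists c; split=> //; split=> [||P hallP|u fix_u].
- by rewrite oc.
- apply/subsetP=> y Gy; have nNy := subsetP (normal_norm nsNG) y Gy.
  rewrite inE nNy -conjg_IirrE; apply/eqP; congr 'chi_(_); apply: Uc.
    by rewrite conjg_IirrE -(cfConjgRes _ nsNG nsMG) // cM (inertiaJ (subsetP Ia y Gy)).
  by rewrite conjg_IirrE cfDet_order_conjg.
- have [sPN piP pi'NP] := and3P hallP.
  have sPM : P \subset M.
    have nMP := subset_trans sPN (normal_norm nsMN).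
    rewrite -quotient_sub1 //; apply/trivgP/card1_trivg/eqP.
    apply/eqP; apply: (@pnat_1 pi); first exact: quotient_pgroup.
    by apply: pgroupS (quotientS M sPN) _; rewrite /pgroup card_quotient ?normal_norm.
  rewrite -(cfResRes _ sPM sMN) cM; apply: hall_a.
  by rewrite (pHall_subl sPM sMN).
rewrite -aut_IirrE; congr 'chi_(_); apply: Uc; last first.
  by rewrite aut_IirrE cfDet_order_aut.
rewrite aut_IirrE -cfAutRes cM; apply: fix_a.
by move: fix_u; rewrite -(Lagrange sMN) partnM // (part_p'nat pi'NM) muln1.
Qed.

(** A Hall pi-subgroup Q of N supplements M, so that the constituents of the
    induced character are told apart by their irreducible restrictions to Q.
    A field automorphism that fixes the #|Q|-th roots of unity fixes all
    these restrictions, hence the constituents themselves. *)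
Lemma special_over pi M N (b : Iirr M) (d : Iirr N) :
    solvable N -> M <| G -> N <| G -> M \subset N -> pi.-nat #|N : M| ->
    special pi b -> d \in irr_constt ('Ind[N] 'chi_b) -> G \subset 'I['chi_d] ->
  special pi d.
Proof.
move=> solN nsMG nsNG sMN piNM [ob Ib hall_b fix_b] bNd Id.
have nsMN : M <| N := normalS sMN (normal_sub nsNG) nsMG.
have sNG := normal_sub nsNG; have nMN := normal_norm nsMN.
have INb := subset_trans sNG Ib.
have [e e_gt0 dM] := constt_Ind_Res_mult nsMN INb bNd.
have orthQ (Q : {group gT}) : pi.-Hall(N) Q ->
    {in irr_constt ('Ind[N] 'chi_b) &, forall d k,
    '['Res[Q] 'chi_d, 'Res[Q] 'chi_k] = (d == k)%:R}.
  move=> hallQ; have [sQN piQ pi'NQ] := and3P hallQ.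
  apply: cfdot_Res_supplement => //; last first.
    by apply: hall_b; apply: Hall_setI_normal hallQ.
  apply/eqP; rewrite -norm_joinEr ?(subset_trans sQN) // eqEsubset join_subG sMN sQN.
  set J := (M <*> Q)%G; have sJN : J \subset N by rewrite join_subG sMN.
  suffices: #|N : J| == 1%N by rewrite indexg_eq1.
  apply/eqP/(@pnat_1 pi).
    by apply: pnat_dvd piNM; rewrite indexgS // joing_subl.
  by apply: pnat_dvd pi'NQ; rewrite indexgS // joing_subr.
split=> // [|Q hallQ|u fix_u].
(* The power of det d of exponent o(b) is trivial on M. *)
- have lin_d := cfDet_lin_char 'chi_d.
  set o := 'o('chi_b)%CF.
  have kerM x : x \in M -> (cfDet 'chi_d) x ^+ o = 1.
    move=> Mx; rewrite -(cfResE _ sMN Mx) -cfDetRes ?irr_char // dM.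
    rewrite cfDetMn ?irr_char // exp_cfunE // exprAC.
    have -> : cfDet 'chi_b x ^+ o = 1.
      by rewrite -exp_cfunE // exp_cforder cfun1E Mx.
    by rewrite expr1n.
  suffices: ('o('chi_d)%CF %| #|N : M| * o)%N.
    by move=> dv; apply: pnat_dvd dv _; rewrite pnatM piNM ob.
  apply/dvdn_cforderP=> x Nx; rewrite exprM -lin_charX //; apply: kerM.
  have nMx := subsetP nMN x Nx; rewrite coset_idr ?groupX //.
  rewrite morphX //= -card_quotient //; apply/eqP; rewrite -order_dvdn.
  exact: order_dvdG (mem_quotient _ Nx).
- by rewrite irrEchar cfRes_char ?irr_char //= orthQ // eqxx.
have [Q hallQ] := Hall_exists pi solN.
have ubNd : aut_Iirr u d \in irr_constt ('Ind[N] 'chi_b).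
  rewrite constt_Ind_Res irr_consttE aut_IirrE -cfAutRes dM.
  rewrite raddfMn /= fix_b; last first.
    by apply: fixes_roots_dvd fix_u; rewrite partn_dvd ?cardG_gt0 ?cardSg.
  by rewrite cfdotMnl cfnorm_irr pnatr_eq0 -lt0n.
have := orthQ Q hallQ _ _ bNd ubNd.
rewrite aut_IirrE -cfAutRes cfAut_fixed ?cfRes_char ?irr_char //; last first.
  by rewrite (card_Hall hallQ).
rewrite orthQ // eqxx; case: eqP => [Dd _ | _ /eqP]; last by rewrite oner_eq0.
by rewrite -aut_IirrE -Dd.
Qed.

(** * Factoring quasiprimitive characters *)

(** The last clause is the part of the uniqueness of the factorization that
    concerns Galois conjugates; unlike full uniqueness, it passes up a chief
    series without any further irreducibility statement. *)
Definition factored pi1 pi2 M (t : Iirr M) : Prop :=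
  exists a b : Iirr M, [/\ 'chi_t = 'chi_a * 'chi_b, special pi1 a, special pi2 b
    & forall u v, cfAut u 'chi_a * 'chi_b = 'chi_a * cfAut v 'chi_b ->
        cfAut u 'chi_a = 'chi_a /\ cfAut v 'chi_b = 'chi_b].

Lemma factored_sym pi1 pi2 M (t : Iirr M) :
  factored pi1 pi2 t -> factored pi2 pi1 t.
Proof.
case=> a [b [Dt spec_a spec_b uniq_ab]]; exists b, a; split=> //.
  by rewrite mulrC.
move=> u v; rewrite [LHS]mulrC [RHS]mulrC => /esym Duv.
by have [-> ->] := uniq_ab v u Duv.
Qed.

(** Let s = ab and let c be the canonical extension of a. Multiplication by c is
    a bijection from the constituents over b to those over ab, so t = cd for a
    unique d over b; every property of d follows from those of c and t through
    this bijection. *)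
Lemma factored_over pi1 pi2 M N (s : Iirr M) (t : Iirr N) :
    pi2 =i pi1^' -> solvable N -> M <| G -> N <| G -> M \subset N ->
    pi2.-nat #|N : M| -> s \in irr_constt ('Res[M] 'chi_t) ->
    G \subset 'I['chi_t] ->
  factored pi1 pi2 s -> factored pi1 pi2 t.
Proof.
move=> opp solN nsMG nsNG sMN pi2NM tMs It [a [b [Ds spec_a spec_b uniq_ab]]].
have nsMN : M <| N := normalS sMN (normal_sub nsNG) nsMG.
have sNG := normal_sub nsNG.
have pi1'NM : pi1^'.-nat #|N : M| by rewrite -(eq_pnat _ opp).
have [c [cM spec_c Uc]] := special_canonical_ext solN nsMG nsNG sMN pi1'NM spec_a.
have [_ Ic _ _] := spec_c; have [_ Ib _ _] := spec_b.
have INb := subset_trans sNG Ib.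
have irr_ba : 'chi_b * 'chi_a \in irr M by rewrite mulrC -Ds mem_irr.
have [irrM injM constt_ba _] := constt_Ind_mul_ext nsMN cM INb irr_ba.
have : t \in irr_constt ('Ind[N] ('chi_b * 'chi_a)).
  by rewrite mulrC -Ds constt_Ind_Res.
rewrite constt_ba => /imageP[d bNd Dt]; have {}Dt : 'chi_t = 'chi_c * 'chi_d.
  by rewrite Dt cfIirrE ?irrM // mulrC.
have [e e_gt0 dM] := constt_Ind_Res_mult nsMN INb bNd.
have inj_c k : k \in irr_constt ('Ind[N] 'chi_b) ->
    'chi_c * 'chi_k = 'chi_c * 'chi_d -> k = d.
  move=> bNk Dk; apply: injM => //; apply: irr_inj.
  by rewrite !cfIirrE ?irrM // ![_ * 'chi_c]mulrC.
exists c, d; split=> //.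
- apply: (special_over solN nsMG nsNG sMN pi2NM spec_b) => //.
  apply/subsetP=> y Gy; have nNy := subsetP (normal_norm nsNG) y Gy.
  rewrite inE nNy -conjg_IirrE; apply/eqP; congr 'chi_(_); apply: inj_c.
    rewrite constt_Ind_Res irr_consttE conjg_IirrE -(cfConjgRes _ nsNG nsMG) // dM.
    rewrite raddfMn /= (inertiaJ (subsetP Ib y Gy)).
    by rewrite cfdotMnl cfnorm_irr pnatr_eq0 -lt0n.
  rewrite conjg_IirrE -{1}(inertiaJ (subsetP Ic y Gy)).
  by rewrite -rmorphM -Dt /= (inertiaJ (subsetP It y Gy)).
move=> u v Duv; have [] := uniq_ab u v.
  apply/cfun_inP=> x Mx; have := congr1 (fun f : 'CF(N) => f x) Duv.
  have valc : 'chi_c x = 'chi_a x by rewrite -cM cfResE.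
  have vald : 'chi_d x = 'chi_b x *+ e.
    by rewrite -(cfResE _ sMN) // dM -scaler_nat cfunE mulr_natl.
  rewrite !cfunE valc vald raddfMn /= !mulrnAr => Deq.
  by apply: (@mulIf _ e%:R); rewrite ?pnatr_eq0 -?lt0n // !mulr_natr.
move=> ua vb.
have uc : cfAut u 'chi_c = 'chi_c.
  rewrite -aut_IirrE; congr 'chi_(_); apply: Uc.
    by rewrite aut_IirrE -cfAutRes cM.
  by rewrite aut_IirrE cfDet_order_aut.
split=> //; rewrite -aut_IirrE; congr 'chi_(_); apply: inj_c.
  rewrite constt_Ind_Res irr_consttE aut_IirrE -cfAutRes dM raddfMn /= vb.
  by rewrite cfdotMnl cfnorm_irr pnatr_eq0 -lt0n.
by rewrite aut_IirrE -Duv uc.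
Qed.

(** Every chief factor N / M of G below G is a p-group; it is a pi2-group or a
    pi1-group according to p, and in the latter case the two factors exchange
    their roles. *)
Lemma quasiprimitive_factored pi1 pi2 (i : Iirr G) :
    solvable G -> pi2 =i pi1^' ->
    (forall M t, M <| G -> t \in irr_constt ('Res[M] 'chi_i) ->
       G \subset 'I['chi_t]) ->
  factored pi1 pi2 i.
Proof.
move=> solG opp homog.
suffices facN n N : (#|N| <= n)%N -> N <| G ->
    forall t, t \in irr_constt ('Res[N] 'chi_i) -> factored pi1 pi2 t.
  by apply: (facN #|G| G) => //; rewrite cfRes_id irr_consttE cfnorm_irr oner_eq0.
elim: n N => [|n IHn] N leNn nsNG t iNt; first by rewrite leqNgt cardG_gt0 in leNn.
have [N1 | ntN] := eqVneq N 1%G.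
  move: t {iNt}; rewrite {}N1 => t; exists t, t; split; try exact: special1.
    by rewrite (Iirr1_eq0 t) irr0 mulr1.
  by move=> u v _; rewrite (Iirr1_eq0 t) irr0 !rmorph1.
have [M maxM] : {M : {group gT} | maxnormal M N G}.
  by apply: ex_maxgroup; exists 1%G; rewrite proper1G ntN norms1.
have /andP[ltMN nMG] := maxgroupp maxM; have sMN := proper_sub ltMN.
have nsMG : M <| G by rewrite /normal (subset_trans sMN (normal_sub nsNG)).
have nsMN : M <| N := normalS sMN (normal_sub nsNG) nsMG.
have solN := solvableS (normal_sub nsNG) solG.
have [p p_pr pNM] : exists2 p, prime p & p.-nat #|N : M|.
  have minNM : minnormal (N / M) (G / M).
    by apply: chief_factor_minnormal; rewrite /chief_factor maxM.
  have [_ _] := minnormal_solvable minNM (subxx _) (quotient_sol M solN).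
  case/is_abelemP=> p p_pr /abelem_pgroup pNM; exists p => //.
  by move: pNM; rewrite /pgroup card_quotient ?normal_norm.
have [s tMs] := constt_cfRes_irr M t.
have facs : factored pi1 pi2 s.
  apply: (IHn M) => //.
    by rewrite -ltnS (leq_trans (proper_card ltMN)).
  rewrite -(cfResRes _ sMN (normal_sub nsNG)).
  by apply: constt_Res_trans iNt _ tMs; rewrite cfRes_char ?irr_char.
have It := homog N t nsNG iNt.
have [pi1p | pi1'p] := boolP (p \in pi1); last first.
  apply: (factored_over opp _ nsMG nsNG) facs => //.
  by apply: sub_in_pnat pNM => q _; rewrite inE => /eqP->; rewrite opp inE.
apply/factored_sym; apply: (factored_over _ _ nsMG nsNG) (factored_sym facs) => //.
  by move=> q; rewrite !inE /= opp !inE negbK.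
by apply: sub_in_pnat pNM => q _; rewrite inE => /eqP->.
Qed.

End SpecialFactors.

(** * Splitting of stabilisers and the alternating sum *)

Section AlternatingSum.

Variables (gT : finGroupType) (u : nat -> {rmorphism algC -> algC}).
Implicit Types (G H : {group gT}) (s : seq nat).

(** The operators 1 - u p, for p in s, are applied starting from the head of s.
    With this order [aut_diff s] is applied outermost, and commutation of the
    automorphisms is needed on characters only, not on their differences. *)
Fixpoint aut_diff G s (phi : 'CF(G)) : 'CF(G) :=
  if s is p :: s' then aut_diff s' phi - aut_diff s' (cfAut (u p) phi) else phi.

Fact aut_diff_is_zmod_morphism G s : zmod_morphism (@aut_diff G s).
Proof.
elim: s => [|p s IHs] phi psi /=; first by [].
by rewrite raddfB /= !IHs !opprD !opprK !addrA [_ - _ - _]addrAC.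
Qed.
HB.instance Definition _ G s :=
  GRing.isZmodMorphism.Build 'CF(G) 'CF(G) (@aut_diff G s)
    (aut_diff_is_zmod_morphism s).

Lemma aut_diff_Res G H s (phi : 'CF(G)) :
  'Res[H] (aut_diff s phi) = aut_diff s ('Res[H] phi).
Proof.
elim: s phi => [|p s IHs] phi //=.
by rewrite raddfB /= !IHs cfAutRes.
Qed.

Lemma aut_diff_fixed G s p (phi : 'CF(G)) :
    phi \is a character -> p \in s -> cfAut (u p) phi = phi ->
  aut_diff s phi = 0.
Proof.
elim: s phi => // q s IHs phi Nphi; rewrite inE /=.
have [<- _ -> | _ /= s_p up] := eqVneq p q; first by rewrite subrr.
rewrite !IHs ?subrr ?cfAut_char //.
by rewrite cfAut_comm // up.
Qed.

End AlternatingSum.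

Section Quasiprimitive.

Variables (gT : finGroupType) (G : {group gT}) (i : Iirr G).
Hypotheses (solG : solvable G)
  (homog : forall (M : {group gT}) t, M <| G -> t \in irr_constt ('Res[M] 'chi_i) ->
     G \subset 'I['chi_t]).

(** Let w be the inverse of u. The hypothesis says that w and v agree on
    chi = ab. As w fixes b and v fixes a, this reads a^w b = a b^v, and
    uniqueness of the factorization gives a^w = a. *)
Lemma quasiprimitive_split (p : nat) u v :
    fixes_roots u #|G|`_p^' -> fixes_roots v #|G|`_p ->
  cfAut u (cfAut v 'chi_i) = 'chi_i -> cfAut u 'chi_i = 'chi_i.
Proof.
move=> fix_u fix_v Duv.
have opp : p^' =i (p : nat_pred)^' by [].
have [a [b [Di [_ _ _ fix_a] [_ _ _ fix_b] uniq_ab]]] :=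
  quasiprimitive_factored solG opp homog.
have fix_w := fixes_roots_inv fix_u; set w := algC_invaut u in fix_w.
have Dvw : cfAut v 'chi_i = cfAut w 'chi_i.
  by rewrite -{2}Duv cfAutK.
have [wa _] : cfAut w 'chi_a = 'chi_a /\ cfAut v 'chi_b = 'chi_b.
  apply: uniq_ab; move: Dvw; rewrite Di !rmorphM /= fix_a //.
  by rewrite (fix_b _ fix_w) => ->.
rewrite Di rmorphM /= (fix_b _ fix_u); congr (_ * _).
by rewrite -{1}wa cfAutVK.
Qed.

(** The inner product of the alternating sum with chi is 1. The induction on s
    needs a further automorphism v whose action involves none of the primes
    left in s: the term of chi moved by both u p and v is not chi, by splitting
    of the stabiliser. *)
Lemma aut_diff_neq0 (u : nat -> {rmorphism algC -> algC}) s :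
    uniq s -> all prime s ->
    {in s, forall p : nat, fixes_roots (u p) #|G|`_p^'} ->
    {in s, forall p, cfAut (u p) 'chi_i != 'chi_i} ->
  aut_diff u s 'chi_i != 0.
Proof.
move=> uniq_s pr_s fix_u mv_u.
suffices dotD : '[aut_diff u s (cfAut idfun 'chi_i), 'chi_i] = 1.
  apply: contra_eq_neq dotD => D0.
  have ->: cfAut idfun 'chi_i = 'chi_i by apply/cfunP=> x; rewrite cfunE.
  by rewrite D0 cfdot0l eq_sym oner_eq0.
suffices dotD v : {in s, forall p : nat, fixes_roots v #|G|`_p} ->
    '[aut_diff u s (cfAut v 'chi_i), 'chi_i] = (cfAut v 'chi_i == 'chi_i)%:R.
  rewrite dotD //; case: eqP => // -[]; apply/cfunP=> x; rewrite cfunE //.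
elim: s uniq_s pr_s fix_u mv_u v => [|p s IHs] /=.
  by move=> _ _ _ _ v _; rewrite -aut_IirrE cfdot_irr (inj_eq irr_inj).
case/andP=> s'p uniq_s /andP[p_pr pr_s] fix_u mv_u v fix_v.
have ss : {subset s <= p :: s} by move=> q s_q; rewrite inE s_q orbT.
have IH w : {in s, forall q : nat, fixes_roots w #|G|`_q} -> _ :=
  IHs uniq_s pr_s (sub_in1 ss fix_u) (sub_in1 ss mv_u) w.
have s_p : p \in p :: s by rewrite mem_head.
have Dpv : cfAut (u p) (cfAut v 'chi_i) = cfAut (u p \o v) 'chi_i.
  by apply/cfunP=> x; rewrite !cfunE.
rewrite cfdotBl Dpv !IH -?Dpv; first last.
- by move=> q s_q; apply: fix_v; apply: ss.
- move=> q s_q z z1 /=; rewrite (fix_v q) ?ss //; apply: (fix_u p) => //.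
  have /dvdnP[k ->] : (#|G|`_q %| #|G|`_p^')%N.
    apply: sub_in_partn => r _; rewrite !inE => /eqP->.
    by apply: contraNneq s'p => <-.
  by rewrite mulnC exprM z1 expr1n.
suffices /negPf-> : cfAut (u p) (cfAut v 'chi_i) != 'chi_i by rewrite subr0.
apply: contra (mv_u p s_p) => /eqP Duv.
by apply/eqP; apply: quasiprimitive_split Duv; [apply: fix_u | apply: fix_v].
Qed.

End Quasiprimitive.

(** Galois form of the main theorem, free of conductors. Its hypotheses pass
    from a character to its Clifford correspondent, which makes induction on
    the order of G possible. *)
Theorem moved_constituent (gT : finGroupType) (G : {group gT}) (i : Iirr G)
    (u : nat -> {rmorphism algC -> algC}) (s : seq nat) :
    solvable G -> uniq s -> all prime s ->
    {in s, forall p : nat, fixes_roots (u p) #|G|`_p^'} ->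
    {in s, forall p : nat, cfAut (u p) 'chi_i != 'chi_i} ->
  exists (H : {group gT}) (j : Iirr H),
    [/\ H \subset G, cyclic H, j \in irr_constt ('Res[H] 'chi_i)
      & {in s, forall p : nat, cfAut (u p) 'chi_j != 'chi_j}].
Proof.
have [n leGn] := ubnP #|G|; elim: n G leGn i => // n IHn G /ltnSE-leGn i.
move=> solG uniq_s pr_s fix_u mv_u.
have [homog | ] := boolP [forall (M : {group gT} | M <| G),
    [forall (t | t \in irr_constt ('Res[M] 'chi_i)), G \subset 'I['chi_t]]].
  have D_neq0 : aut_diff u s 'chi_i != 0.
    apply: aut_diff_neq0 => // M t nsMG iMt.
    exact: (forall_inP (forall_inP homog M nsMG) t iMt).
  have /existsP[g /andP[Gg Dg]] : [exists g, (g \in G) && (aut_diff u s 'chi_i g != 0)].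
    apply: contraR D_neq0 => /existsPn D0; apply/eqP/cfun_inP=> g Gg; apply/eqP.
    by have := D0 g; rewrite Gg negbK cfunE.
  have sHG : <[g]> \subset G by rewrite cycle_subG.
  have DH : aut_diff u s ('Res[<[g]>] 'chi_i) != 0.
    rewrite -aut_diff_Res; apply: contraNneq Dg => D0.
    by rewrite -(cfResE _ sHG) ?cycle_id // D0 cfunE.
  have /existsP[j /andP[iHj Dj]] : [exists j, (j \in irr_constt ('Res[<[g]>] 'chi_i))
      && (aut_diff u s 'chi_j != 0)].
    apply: contraR DH => /existsPn D0; apply/eqP.
    rewrite (cfun_sum_constt ('Res 'chi_i)) raddf_sum big1 // => j iHj.
    have /natrP[m ->] : '['Res[<[g]>] 'chi_i, 'chi_j] \in Num.nat.
      by rewrite Cnat_cfdot_char ?cfRes_char ?irr_char.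
    rewrite scaler_nat raddfMn; have := D0 j; rewrite iHj /= negbK => /eqP->.
    by rewrite mul0rn.
  exists <[g]>%G, j; split=> // [|p s_p]; first exact: cycle_cyclic.
  by apply: contra Dj => /eqP up; apply/eqP/(aut_diff_fixed (irr_char j) s_p).
case/forall_inPn=> M nsMG /forall_inPn[t iMt not_It].
set T := 'I_G['chi_t]%G.
have sTG : T \subset G by apply: subsetIl.
have ltTG : (#|T| < #|G|)%N.
  apply: proper_card; rewrite properEneq sTG andbT.
  by apply: contra not_It => /eqP <-; apply: subsetIr.
have [irrInd _ defB _ _] := constt_Inertia_bijection t nsMG.
have : i \in irr_constt ('Ind[G] 'chi_t) by rewrite constt_Ind_Res.
rewrite -defB => /imsetP[r Tr Di].
have {}Di : 'chi_i = 'Ind 'chi_r by rewrite Di cfIirrE ?irrInd.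
have [|||p s_p|H [j [sHT cycH rHj mv_j]]] := IHn T _ r _ uniq_s pr_s _.
- exact: leq_trans ltTG leGn.
- exact: solvableS solG.
- move=> p s_p; apply: fixes_roots_dvd (fix_u p s_p).
  by rewrite partn_dvd ?cardG_gt0 ?cardSg.
- by apply: contra (mv_u p s_p) => /eqP ur; rewrite Di cfAutInd ur.
exists H, j; split=> //; first exact: subset_trans sHT sTG.
rewrite -(cfResRes _ sHT sTG); apply: constt_Res_trans rHj.
  by rewrite cfRes_char ?irr_char.
by rewrite -constt_Ind_Res -Di irr_consttE cfnorm_irr oner_eq0.
Qed.

(** * Galois description of the conductor *)

Lemma cyclotomic_field_expansion n w x :
    n.-primitive_root w -> cyclotomic_field n x ->
  exists m (a : nat -> rat), x = \sum_(i < m) ratr (a i) * w ^+ i.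
Proof.
move=> prim_w Qx; have [L [f [s1 Ds genL]]] := num_field_exists [:: w].
case: s1 Ds genL => [|y [|? ?]] //= [Dy]; rewrite adjoin_seq1 => genL.
have [v ->] : exists v, x = f v.
  elim: {x} Qx => [x | | _ _ _ [v ->] _ [v' ->] | _ _ _ [v ->] _ [v' ->]].
  - move/prim_expr_order/(prim_rootP prim_w)=> [k ->].
    by exists (y ^+ k); rewrite rmorphXn Dy.
  - by exists 1; rewrite rmorph1.
  - by exists (v - v'); rewrite rmorphB.
  by exists (v / v'); rewrite fmorph_div.
have: v \in <<1; y>>%VS by rewrite genL memvf.
case/Fadjoin_polyP=> q /polyOverP q1 ->.
have [a Da] : exists a : nat -> rat, forall i, q`_i = (a i)%:A.
  have sgQ i : {a | q`_i = a%:A}.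
    by apply: sig_eqW; have /vlineP[a ->] := q1 i; exists a.
  by exists (fun i => sval (sgQ i)) => i; case: (sgQ i).
exists (size q), a; rewrite horner_coef rmorph_sum; apply: eq_bigr => i _.
by rewrite rmorphM rmorphXn Dy Da alg_num_field fmorph_rat.
Qed.

(** Expand x over the powers of w and average over the exponents
    k t = 1 + t * (c / p) that are prime to p. For i prime to p, the sum of
    w ^+ (k t * i) over all t < p vanishes, being a multiple of the sum of the
    powers of a nontrivial p-th root of unity; the terms left out have k t
    divisible by p and so lie in the field of c / p. For i divisible by p all
    terms lie in that field. *)
Lemma cyclotomic_field_descent c p (w x : algC) :
    prime p -> (p %| c)%N -> c.-primitive_root w -> cyclotomic_field c x ->
    (forall t, (t < p)%N -> ~~ (p %| 1 + t * (c %/ p))%N ->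
      exists2 u : {rmorphism algC -> algC},
        u w = w ^+ (1 + t * (c %/ p)) & u x = x) ->
  cyclotomic_field (c %/ p) x.
Proof.
move=> p_pr p_c prim_w Qx; set d := (c %/ p)%N; pose k t := (1 + t * d)%N.
rewrite -/k => fix_x; have p_gt0 := prime_gt0 p_pr.
have Dc : c = (d * p)%N by rewrite divnK.
have prim_wp : d.-primitive_root (w ^+ p).
  have d_gt0 : (0 < d)%N.
    by move: (prim_order_gt0 prim_w); rewrite Dc muln_gt0 => /andP[].
  have d_c : (d %| c)%N by rewrite Dc dvdn_mulr.
  by have := dvdn_prim_root prim_w d_c; rewrite {1}Dc mulKn.
have Q_wp m : (p %| m)%N -> cyclotomic_field d (w ^+ m).
  by case/dvdnP=> q ->; rewrite mulnC exprM; apply/genX/gen_mem.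
have [m [a Dx]] := cyclotomic_field_expansion prim_w Qx.
pose A := [pred t : 'I_p | ~~ (p %| k t)%N].
have A_gt0 : (0 < #|A|)%N.
  apply/card_gt0P; exists (Ordinal p_gt0).
  by rewrite inE /= /k mul0n addn0 gtnNdvd ?prime_gt1.
have Q_sum i : cyclotomic_field d (\sum_(t in A) w ^+ (k t * i)).
  have [p_i | p'i] := boolP (p %| i)%N.
    by apply: gen_sum => t _; apply: Q_wp; apply: dvdn_mull.
  have sum0 : \sum_(t < p) w ^+ (k t * i) = 0.
    pose z := w ^+ (d * i).
    have z_neq1 : z - 1 != 0.
      rewrite subr_eq0 -(prim_order_dvd prim_w) Dc dvdn_pmul2l //.
      exact: prim_order_gt0 prim_wp.
    transitivity (w ^+ i * \sum_(t < p) z ^+ t).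
      rewrite mulr_sumr; apply: eq_bigr => t _.
      rewrite -exprM -exprD; congr (_ ^+ _).
      by rewrite /k mulnDl mul1n -mulnA [(t * _)%N]mulnC.
    apply/eqP; rewrite mulf_eq0 orbC -(inj_eq (mulfI z_neq1)) -subrX1 mulr0.
    by rewrite -exprM mulnAC -Dc exprM (prim_expr_order prim_w) expr1n subrr eqxx.
  move: sum0; rewrite (bigID [in A]) /= => /(canRL (addrK _))->.
  apply: gen_sub; first exact: Defs.gen0.
  apply: gen_sum => t /negbNE p_k.
  by apply: Q_wp; apply: dvdn_mulr.
have -> : x = (\sum_(i < m) ratr (a i) * \sum_(t in A) w ^+ (k t * i)) / #|A|%:R.
  apply: (@mulIf _ #|A|%:R); first by rewrite pnatr_eq0 -lt0n.
  rewrite divfK ?pnatr_eq0 -?lt0n // mulr_natr -sumr_const.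
  under [RHS]eq_bigr => i _ do rewrite mulr_sumr.
  rewrite exchange_big; apply: eq_bigr => t /= p'k.
  have [u uw <-] := fix_x t (ltn_ord t) p'k.
  rewrite {1}Dx rmorph_sum; apply: eq_bigr => i _.
  by rewrite rmorphM fmorph_rat rmorphXn uw -exprM.
rewrite -(ratr_nat algC #|A|); apply: gen_div (gen_rat _ _).
by apply: gen_sum => i _; apply: genM (Q_sum i); apply: gen_rat.
Qed.

(** The exponent k is only prescribed modulo c. The Chinese remainder theorem
    gives an exponent that is k modulo the p-part of n * c and 1 modulo its
    p'-part; it is congruent to k modulo c because k is 1 modulo c / p. *)
Lemma partial_power_aut c n p k :
    prime p -> (0 < c)%N -> (0 < n)%N -> (p %| c)%N ->
    ~~ (p %| k)%N -> (k = 1 %[mod c %/ p])%N ->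
  exists2 u : {rmorphism algC -> algC},
    fixes_roots u (lcmn (c %/ p) n`_p^')
    & forall z, z ^+ c = 1 -> u z = z ^+ k.
Proof.
move=> p_pr c_gt0 n_gt0 p_c p'k k1.
have d_c : (c %/ p %| c)%N by rewrite dvdn_div.
have N_gt0 : (0 < n * c)%N by rewrite muln_gt0 n_gt0.
set N := (n * c)%N in N_gt0; set Np := (N`_p)%N; set Np' := (N`_p^')%N.
have coN : coprime Np Np' by rewrite coprime_partC.
pose l := chinese Np Np' k 1.
have l_k : (l = k %[mod Np])%N := chinese_modl coN k 1.
have l_1 : (l = 1 %[mod Np'])%N := chinese_modr coN k 1.
have DN : (Np * Np' = N)%N by rewrite partnC.
have co_l : coprime l N.
  rewrite -DN coprimeMr -coprime_modl l_k coprime_modl.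
  rewrite -[X in _ && X]coprime_modl l_1 coprime_modl coprime1n andbT.
  by rewrite /Np p_part coprimeXr // coprime_sym prime_coprime.
have l_c : (l = k %[mod c])%N.
  apply/eqP; rewrite -(partnC p c_gt0) chinese_remainder ?coprime_partC //.
  have c_N pi : (c`_pi %| N`_pi)%N by rewrite partn_dvd // dvdn_mull.
  have down a b m q : (q %| m)%N -> (a = b %[mod m])%N -> (a == b %[mod q])%N.
    by move=> q_m eq_ab; rewrite -(modn_dvdm a q_m) eq_ab modn_dvdm.
  rewrite (down _ _ _ _ (c_N _) l_k) /=.
  have c_d : (c`_p^' %| c %/ p)%N.
    rewrite -{2}(partnC p c_gt0) p_part.
    have e_gt0 : (0 < logn p c)%N by rewrite logn_gt0 mem_primes p_pr c_gt0.
    by rewrite -(prednK e_gt0) expnS -mulnA mulKn ?prime_gt0 // dvdn_mull.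
  rewrite (eqP (down _ _ _ _ (c_N _) l_1)) eq_sym.
  exact: down c_d k1.
have [u Du] := Qn_aut_exists co_l; exists u => z z1; last first.
  rewrite Du; last by rewrite /N mulnC exprM z1 expr1n.
  by rewrite -(expr_mod l z1) l_c expr_mod.
have l_m : (l = 1 %[mod lcmn (c %/ p) n`_p^'])%N.
  have l_gt0 : (0 < l)%N.
    rewrite lt0n; apply: contraTneq co_l => ->; rewrite /coprime gcd0n.
    apply: contraTneq p_c => N1; have : (c %| 1)%N by rewrite -N1 dvdn_mull.
    by rewrite dvdn1 => /eqP->; rewrite Euclid_dvd1.
  apply/eqP; rewrite eqn_mod_dvd // dvdn_lcm -!eqn_mod_dvd //.
  rewrite -(modn_dvdm l d_c) l_c modn_dvdm // k1 eqxx /=.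
  have n_N : (n`_p^' %| Np')%N by rewrite partn_dvd // dvdn_mulr.
  by rewrite -(modn_dvdm l n_N) l_1 modn_dvdm.
have m_N : (lcmn (c %/ p) n`_p^' %| N)%N.
  by rewrite dvdn_lcm (dvdn_trans d_c (dvdn_mull n _)) // dvdn_mulr ?dvdn_part.
rewrite Du; last by case/dvdnP: m_N => q ->; rewrite mulnC exprM z1 expr1n.
by rewrite -(expr_mod l z1) l_m expr_mod.
Qed.

(** If all power automorphisms of the above kind fixed chi, averaging would put
    its values in the cyclotomic field of c / p, against the minimality of the
    conductor c. *)
Lemma conductor_prime_moved (gT : finGroupType) (G : {group gT}) (i : Iirr G) p :
    prime p -> (p %| conductor i)%N ->
  exists2 u : {rmorphism algC -> algC},
    fixes_roots u (lcmn (conductor i %/ p) #|G|`_p^') & cfAut u 'chi_i != 'chi_i.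
Proof.
have [c_gt0 Qc min_c] := conductorP i; set c := conductor i in c_gt0 Qc min_c *.
move=> p_pr p_c; have p_gt0 := prime_gt0 p_pr.
have [w prim_w] := C_prim_root_exists c_gt0; pose k t := (1 + t * (c %/ p))%N.
have /fin_all_exists[u Du] (t : 'I_p) : exists u : {rmorphism algC -> algC},
    ~~ (p %| k t)%N ->
    fixes_roots u (lcmn (c %/ p) #|G|`_p^') /\ u w = w ^+ k t.
  have [p_k | p'k] := boolP (p %| k t)%N; first by exists idfun.
  have [|u fix_u uw] := partial_power_aut p_pr c_gt0 (cardG_gt0 G) p_c p'k.
    by rewrite /k addnC modnMDl.
  by exists u => _; split=> //; apply: uw; apply: prim_expr_order.
have [/existsP[t /andP[p'k ut]] | /existsPn fix_i] := boolP
    [exists t : 'I_p, ~~ (p %| k t)%N && (cfAut (u t) 'chi_i != 'chi_i)].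
  by exists (u t) => //; have [] := Du t p'k.
suffices /(min_c _): field_incl (char_field 'chi_i) (cyclotomic_field (c %/ p)).
  rewrite divn_gt0 // (dvdn_leq c_gt0 p_c) => /(_ isT).
  by rewrite leqNgt ltn_Pdiv ?prime_gt1.
apply: gen_field_sub => _ [x Gx ->].
apply: (cyclotomic_field_descent p_pr p_c prim_w).
  by apply: Qc; apply: gen_mem; exists x.
move=> t ltp p'k; pose t' := Ordinal ltp; have [_ uw] := Du t' p'k.
exists (u t') => //; have := fix_i t'; rewrite p'k negbK => /eqP ui.
by rewrite -[in RHS]ui cfunE.
Qed.

Lemma lin_char_fixed (gT : finGroupType) (H : {group gT}) u n (phi : 'CF(H)) :
  phi \is a linear_char -> (#[phi]%CF %| n)%N -> fixes_roots u n ->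
  cfAut u phi = phi.
Proof.
move=> lin_phi /dvdn_cforderP phi_n fix_u; apply/cfun_inP=> x Hx.
by rewrite cfunE fix_u ?phi_n.
Qed.

Unset Implicit Arguments.

Theorem theorem9p4 (gT : finGroupType) (G : {group gT}) (i : Iirr G) :
  solvable G ->
  exists (H : {group gT}) (j : Iirr H),
    [/\ H \subset G, cyclic H, j \in irr_constt ('Res[H] 'chi_i)
      & (conductor i %| #['chi_j]%CF)%N].
Proof.
move=> solG; have [c_gt0 _ _] := conductorP i.
set c := conductor i in c_gt0 *.
have /fin_all_exists[u Du] (p : 'I_c.+1) : exists u : {rmorphism algC -> algC},
    val p \in primes c ->
    fixes_roots u (lcmn (c %/ p) #|G|`_p^') /\ cfAut u 'chi_i != 'chi_i.
  have [ | p'c] := boolP (val p \in primes c); last by exists idfun.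
  rewrite mem_primes => /and3P[p_pr _ p_c].
  by have [v fix_v vi] := conductor_prime_moved p_pr p_c; exists v.
have {}Du p : p \in primes c ->
    fixes_roots (u (inord p)) (lcmn (c %/ p) #|G|`_p^')
    /\ cfAut (u (inord p)) 'chi_i != 'chi_i.
  move=> c_p; have Dp : (inord p : 'I_c.+1) = p :> nat.
    rewrite inordK // ltnS dvdn_leq //.
    by move: c_p; rewrite mem_primes => /and3P[].
  by have := Du (inord p); rewrite /= Dp; apply.
have [||||H [j [sHG cycH iHj mv_j]]] :=
  @moved_constituent gT G i (fun p => u (inord p)) (primes c) solG.
- exact: primes_uniq.
- by apply/allP=> p; rewrite mem_primes => /andP[].
- move=> p c_p; apply: fixes_roots_dvd (proj1 (Du p c_p)); exact: dvdn_lcmr.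
- by move=> p c_p; apply: proj2 (Du p c_p).
exists H, j; split=> //; have lin_j := irr_cyclic_lin j cycH.
apply/dvdn_partP=> // p c_p; apply: contraR (mv_j p c_p) => not_cp_o.
apply/eqP; apply: lin_char_fixed (proj1 (Du p c_p)) => //.
(* If the p-part of c does not divide o(lambda), the p-part of o(lambda)
   divides c / p, so the automorphism attached to p fixes the values of
   lambda. *)
set o := #['chi_j]%CF in not_cp_o *.
have o_gt0 : (0 < o)%N by apply: cforder_lin_char_gt0.
have o_G : (o %| #|G|)%N.
  exact: dvdn_trans (cforder_lin_char_dvdG lin_j) (cardSg sHG).
have [p_pr _ p_dv_c] := and3P (etrans (esym (mem_primes p c)) c_p).
rewrite -(partnC p o_gt0) Gauss_dvd ?coprime_partC //; apply/andP; split.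
  apply: dvdn_trans (dvdn_lcml _ _).
  move: not_cp_o; rewrite p_part !pfactor_dvdn // -ltnNge => lt_oc.
  have cp_gt0 : (0 < c %/ p)%N by rewrite divn_gt0 ?prime_gt0 // dvdn_leq.
  rewrite p_part (pfactor_dvdn _ p_pr cp_gt0) (logn_div _ p_dv_c).
  by rewrite (logn_prime _ p_pr) eqxx leq_subRL ?add1n // (leq_ltn_trans _ lt_oc).
by apply: dvdn_trans (dvdn_lcmr _ _); rewrite partn_dvd.
Qed.
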